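(* Let $G$ be a finite group. (1) The largest $n$ such that $B(n)$ is embeddable as a join-semilattice of $L(G)$ is $\mu'(G)$. (2) The largest $n$ such that $B(n)$ is embeddable as a meet-semilattice of $L(G)$ in such a way that the minimal element is a normal subgroup of $G$ is $b_2(G)$.
   Context: $L(G)$ is the lattice of subgroups of $G$, with $H\wedge K=H\cap K$ and $H\vee K=\langle H,K\rangle$. A meet-semilattice of $L(G)$ is a collection of subgroups of $G$ containing $G$ and closed under $\wedge$; a join-semilattice of $L(G)$ is a collection of subgroups of $G$ containing the trivial subgroup $1$ and closed under $\vee$. The Boolean lattice $B(n)$ is the lattice of all subsets of an $n$-element set ($n\ge 0$). $B(n)$ is embeddable as a meet-semilattice (respectively join-semilattice) of $L(G)$ if some meet-semilattice (respectively join-semilattice) of $L(G)$ is isomorphic to $B(n)$ with the operation $\cap$ (respectively $\cup$); the minimal element in (2) is the smallest subgroup in this meet-semilattice, the image of the empty set. A subset of $G$ is independent if none of its elements lies in the subgroup generated by the other elements. $\mu(G)$ is the maximal size of an independent generating set of $G$, and $\mu'(G)=\max\{\mu(H):H\le G\}$; equivalently, $\mu'(G)$ is the maximum size of an independent subset of $G$. A permutation representation of $G$ is a homomorphism from $G$ to the group of permutations of a set $\Omega$ (not necessarily faithful). A base for the representation is a finite sequence of points of $\Omega$ whose pointwise stabiliser in the permutation group induced by $G$ is the identity; equivalently, the pointwise stabiliser in $G$ of the sequence is the kernel of the representation. A base is minimal if no point of the sequence is fixed by the pointwise stabiliser of the other points in the sequence. The size of a base is the number of its terms. $b_2(G)$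 is the maximum, over all permutation representations of $G$ (not necessarily faithful), of the maximum size of a minimal base. *)

(* Defs.v *)
From mathcomp Require Import all_boot all_fingroup.
From mathcomp Require Import boolp.

Set Implicit Arguments.
Unset Strict Implicit.
Unset Printing Implicit Defensive.

Local Open Scope group_scope.

Definition is_largest (P : nat -> Prop) (n : nat) : Prop :=
  P n /\ (forall m, P m -> m <= n).

Section SubgroupSemilattices.

Variables (gT : finGroupType) (G : {group gT}).
Implicit Types (S : {set {group gT}}) (n : nat).

Definition join_semilattice S : Prop :=
  [/\ {in S, forall H : {group gT}, H \subset G},
      1%G \in S
    & {in S &, forall H K : {group gT}, (H <*> K)%G \in S}].

Definition meet_semilattice S : Prop :=
  [/\ {in S, forall H : {group gT}, H \subset G},
      G \in S
    & {in S &, forall H K : {group gT}, (H :&: K)%G \in S}].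

(* B(n) is {set 'I_n}; an isomorphism onto S is an injective semilattice      *)
(* morphism into {group gT} with image S.                                     *)
Definition join_iso n S (f : {set 'I_n} -> {group gT}) : Prop :=
  [/\ injective f,
      f @: [set: {set 'I_n}] = S
    & {morph f : A B / A :|: B >-> (A <*> B)%G}].

Definition meet_iso n S (f : {set 'I_n} -> {group gT}) : Prop :=
  [/\ injective f,
      f @: [set: {set 'I_n}] = S
    & {morph f : A B / A :&: B >-> (A :&: B)%G}].

Definition join_embeddable n : Prop :=
  exists S (f : {set 'I_n} -> {group gT}),
    join_semilattice S /\ join_iso S f.

Definition normal_meet_embeddable n : Prop :=
  exists S (f : {set 'I_n} -> {group gT}),
    [/\ meet_semilattice S, meet_iso S f & f set0 <| G].

End SubgroupSemilattices.

Section IndependentSets.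

Variable gT : finGroupType.
Implicit Types (X : {set gT}) (G H : {group gT}).

Definition independent X : bool := [forall x in X, x \notin <<X :\ x>>].

(* The family is never empty: a minimal generating set of G is independent.   *)
Definition mu G : nat :=
  \max_(X : {set gT} | independent X && (<<X>> == G)) #|X|.

Definition mu' G : nat := \max_(H : {group gT} | H \subset G) mu H.

End IndependentSets.

Section MinimalBases.

Variables (gT : finGroupType) (G : {group gT}).

(* A permutation representation of G is an action of G on an arbitrary,       *)
(* possibly infinite, type. A sequence of n points is a function on 'I_n, and *)
(* "the other points" are the terms with another index, so a minimal base has *)
(* no repeated term.                                                          *)
Section Representation.

Variables (Omega : Type) (to : action G Omega) (n : nat) (p : 'I_n -> Omega).

Definition fixes (a : gT) (x : Omega) : Prop := to x a = x.

Definition is_base : Prop :=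
  forall a, a \in G -> (forall i, fixes a (p i)) -> forall x, fixes a x.

Definition is_minimal_base : Prop :=
  is_base /\
  (forall i, ~ (forall a, a \in G -> (forall j, j != i -> fixes a (p j)) ->
                fixes a (p i))).

End Representation.

Definition minimal_base_size (n : nat) : Prop :=
  exists (Omega : Type) (to : action G Omega) (p : 'I_n -> Omega),
    is_minimal_base to p.

Lemma minimal_base_size0 : exists n, `[< minimal_base_size n >].
Proof.
exists 0; apply/asboolP.
have aP : is_action G (fun (x : unit) (_ : gT) => x) by split=> // a [] [].
exists unit, (Action aP), (fun=> tt); split=> [a _ _ []|[]] //.
Qed.

Lemma minimal_base_size_bound n : `[< minimal_base_size n >] -> n <= #|G|.
Proof.
move=> /asboolP[Omega [to [p [_ minp]]]].
have /choice[a aP] i : exists a, [/\ a \in G,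
    forall j, j != i -> fixes to a (p j) & ~ fixes to a (p i)].
  apply: contrapT => noa; apply: (minp i) => a Ga fixa.
  by apply: contrapT => nfix; apply: noa; exists a.
have inj_a : injective a.
  move=> i j eq_a; apply/eqP; apply: contrapT => /negP ne_ij.
  have [_ fixi _] := aP j; have [_ _ []] := aP i.
  by rewrite eq_a; apply: fixi.
rewrite -[n]card_ord -(card_codom inj_a); apply/subset_leq_card/subsetP.
by move=> _ /codomP[i ->]; case: (aP i).
Qed.

Definition b2 : nat := ex_maxn minimal_base_size0 minimal_base_size_bound.

End MinimalBases.

(* Main.v *)
Require Import Defs.
From mathcomp Require Import all_boot all_fingroup.
From mathcomp Require Import boolp.

Set Implicit Arguments.
Unset Strict Implicit.
Unset Printing Implicit Defensive.

(** Each of the two numbers is the largest size of a family that carries the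
    same information as an embedding of a Boolean lattice, and the proof
    translates families into embeddings and back.

    For joins the families are the independent ones.  An independent family x
    gives the embedding sending A to the subgroup generated by the x i with i
    in A; conversely, from a join embedding f one picks, for every i, an
    element of f {i} outside the image f (~ {i}) of the complementary coatom.
    Such an element exists because otherwise f would identify the coatom with
    the top, and the chosen elements are independent because all those of
    index j != i lie in f (~ {i}).  The lemmas are
    [join_embeddable_independent] and [independent_join_embeddable].

    For meets the families are the minimal bases.  A minimal base p gives the
    embedding sending A to the pointwise stabiliser of the p i with i outside
    A; the empty set goes to the kernel of the representation, which is
    normal.  Conversely, let N = f {} be normal, and let G act by right
    multiplication on the subsets of the quotient by N.  In this action N is
    trivial and the stabiliser of f (~ {i}) / N is f (~ {i}), so these n
    points form a base because the coatoms intersect in N.  It is minimal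
    because f {i} fixes every other point but is not contained in f (~ {i}).
    The lemmas are [minimal_base_normal_meet_embeddable] and
    [normal_meet_embeddable_minimal_base]. *)

Local Open Scope group_scope.

(** * Join embeddings and independent sets *)

Section Joins.

Variables (gT : finGroupType) (G : {group gT}).

(** Being the size of an independent subset of G holds of 0 and is preserved by
    maxima, hence passes to the iterated maximum. *)
Lemma mu'_attained :
  exists X : {set gT}, [/\ independent X, X \subset G & #|X| = mu' G].
Proof.
pose P m := exists X : {set gT}, [/\ independent X, X \subset G & #|X| = m].
have P0 : P 0.
  exists set0; rewrite sub0set cards0; split=> //.
  by apply/forall_inP=> x; rewrite inE.
have Pmax m n : P m -> P n -> P (maxn m n).
  by move=> Pm Pn; rewrite /maxn; case: ifP.
rewrite -/(P _) /mu' /mu; apply: (big_ind P) => // H sHG.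
apply: (big_ind P) => // X /andP[indX /eqP defH].
by exists X; split=> //; apply: subset_trans sHG; rewrite -defH subset_gen.
Qed.

Lemma leq_card_mu' (X : {set gT}) :
  independent X -> X \subset G -> #|X| <= mu' G.
Proof.
move=> indX sXG; have sgXG : <<X>>%G \subset G by rewrite gen_subG.
apply: leq_trans (leq_bigmax_cond (F := @mu gT) _ sgXG).
by apply: (leq_bigmax_cond (F := fun Y : {set gT} => #|Y|)); rewrite indX eqxx.
Qed.

Lemma independent_join_embeddable (X : {set gT}) :
  independent X -> X \subset G -> join_embeddable G #|X|.
Proof.
move=> /forall_inP indX sXG.
pose x (i : 'I_#|X|) : gT := enum_val i.
have xX i : x i \in X by apply: enum_valP.
have inj_x : injective x by apply: enum_val_inj.
have mem_f (A : {set 'I_#|X|}) i : (x i \in <<x @: A>>) = (i \in A).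
  apply/idP/idP=> [|Ai]; last by rewrite mem_gen ?imset_f.
  apply: contraLR => nAi; apply: contra (indX _ (xX i)); apply/subsetP/genS.
  apply/subsetP=> _ /imsetP[j Aj ->]; rewrite !inE xX andbT.
  by apply: contraNneq nAi => /inj_x <-.
pose f (A : {set 'I_#|X|}) : {group gT} := [group of <<x @: A>>].
have fU : {morph f : A B / A :|: B >-> (A <*> B)%G}.
  by move=> A B; apply: val_inj; rewrite /= imsetU joing_idl joing_idr.
exists (f @: setT), f; split; split=> //.
- move=> _ /imsetP[A _ ->]; rewrite gen_subG.
  by apply/subsetP=> _ /imsetP[i _ ->]; apply: (subsetP sXG).
- apply/imsetP; exists set0 => //; apply: val_inj.
  by rewrite /= imset0 gen0.
- move=> _ _ /imsetP[A _ ->] /imsetP[B _ ->].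
  by rewrite -fU imset_f.
move=> A B eqAB; apply/setP=> i.
by rewrite -!mem_f; have /= -> := congr1 val eqAB.
Qed.

Lemma join_embeddable_independent n :
  join_embeddable G n ->
  exists X : {set gT}, [/\ independent X, X \subset G & #|X| = n].
Proof.
move=> [S [f [[sSG _ _] [inj_f defS fU]]]].
have fS (A B : {set 'I_n}) : A \subset B -> f A \subset f B.
  by move=> /setUidPr <-; rewrite fU joing_subl.
have /choice[x xP] i : exists a, a \in f [set i] :\: f [set~ i].
  apply/set0Pn; rewrite setD_eq0; apply/negP=> sfi.
  (* the coatom would thus have the same image as the top *)
  have /inj_f/setP/(_ i) : f ([set i] :|: [set~ i]) = f [set~ i].
    by apply: val_inj; rewrite fU /=; apply/joing_idPr.
  by rewrite !inE eqxx.
have x_i i : x i \in f [set i] by have /setDP[] := xP i.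
have xNi i : x i \notin f [set~ i] by have /setDP[] := xP i.
have x_ij i j : j != i -> x j \in f [set~ i].
  move=> ne_ji; apply: subsetP (x_i j); apply: fS.
  by rewrite sub1set !inE.
have inj_x : injective x.
  move=> i j eq_x; apply: contraNeq (xNi j) => ne_ij.
  by rewrite -eq_x x_ij.
exists (x @: setT); split; last by rewrite card_imset // cardsT card_ord.
- apply/forall_inP=> _ /imsetP[i _ ->]; apply: contra (xNi i).
  apply/subsetP; rewrite gen_subG.
  apply/subsetP=> y /setD1P[ne_y /imsetP[j _ def_y]].
  by rewrite def_y in ne_y *; apply: x_ij; apply: contraNneq ne_y => ->.
- apply/subsetP=> _ /imsetP[i _ ->]; apply: subsetP (x_i i).
  by apply: sSG; rewrite -defS imset_f.
Qed.

End Joins.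

(** * Meet embeddings and minimal bases *)

Section Meets.

Variables (gT : finGroupType) (G : {group gT}).

(** The pointwise stabiliser of the points of index outside A, rather than in
    A, so that it grows with A. *)
Definition costab (Omega : Type) (to : action G Omega) n (p : 'I_n -> Omega)
    (A : {set 'I_n}) : {set gT} :=
  [set a in G | `[< forall i, i \notin A -> fixes to a (p i) >]].

Section Stabilisers.

Variables (Omega : Type) (to : action G Omega) (n : nat) (p : 'I_n -> Omega).

Lemma actionM x a b : a \in G -> b \in G -> to x (a * b) = to (to x a) b.
Proof. by case: to => /= act [_ actM] Ga Gb; apply: actM. Qed.

Lemma action1 x : to x 1 = x.
Proof.
have inj1 : injective (to^~ 1).
  by case: to => /= act [inj_act _]; apply: inj_act.
by apply: inj1; rewrite -actionM ?group1 // mulg1.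
Qed.

Lemma costabP (A : {set 'I_n}) a :
  reflect (a \in G /\ forall i, i \notin A -> fixes to a (p i))
          (a \in costab to p A).
Proof.
rewrite inE; apply: (iffP andP) => -[Ga fixA]; split=> //.
  by apply/asboolP.
exact/asboolP.
Qed.

Lemma costab_group_set A : group_set (costab to p A).
Proof.
apply/group_setP; split=> [|a b /costabP[Ga fa] /costabP[Gb fb]].
  by apply/costabP; split=> // i _; apply: action1.
apply/costabP; split=> [|i nAi]; first exact: groupM.
by rewrite /fixes actionM // fa // fb.
Qed.

Canonical costab_group A := Group (costab_group_set A).

Lemma costabT : costab to p setT = G.
Proof.
by apply/setP=> a; apply/costabP/idP=> [[]|Ga] //; split=> // i; rewrite inE.
Qed.

Lemma costabI A B : costab to p (A :&: B) = costab to p A :&: costab to p B.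
Proof.
apply/setP=> a; rewrite in_setI; apply/costabP/andP.
  move=> [Ga fa]; split; apply/costabP; split=> // i nAi;
  by apply: fa; rewrite inE (negPf nAi) ?andbF.
move=> [/costabP[Ga fA] /costabP[_ fB]]; split=> // i.
by rewrite inE negb_and => /orP[/fA | /fB].
Qed.

(** For a base, fixing the points p i is the same as fixing all of Omega, and
    the latter condition is invariant under conjugation. *)
Lemma costab0_normal : is_base to p -> costab to p set0 <| G.
Proof.
move=> baseP; have fix0 a : a \in costab to p set0 -> forall x, fixes to a x.
  by move=> /costabP[Ga fa]; apply: baseP => // i; apply: fa; rewrite inE.
apply/normalP; split=> [|g Gg]; first by apply/subsetP=> a /costabP[].
have sub h : h \in G -> costab to p set0 :^ h \subset costab to p set0.
  move=> Gh; apply/subsetP=> _ /imsetP[a K_a ->].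
  have /costabP[Ga _] := K_a; apply/costabP; split=> [|i _].
    by rewrite groupJ.
  rewrite /fixes conjgE !actionM ?groupM ?groupV // (fix0 _ K_a).
  by rewrite -actionM ?groupV // mulVg action1.
by apply/eqP; rewrite eqEsubset sub //= -sub_conjgV sub ?groupV.
Qed.

(** Minimality gives an element that moves p i and fixes the other terms; it
    lies in [costab to p A] exactly when i is in A, so the stabilisers
    determine A. *)
Lemma costab_inj : is_minimal_base to p -> injective (costab to p).
Proof.
move=> [_ minp].
have sub A B : costab to p A = costab to p B -> A \subset B.
  move=> eqAB; apply/subsetP=> i Ai; apply: contraT => nBi.
  case: (minp i) => a Ga fa.
  have : a \in costab to p A.
    by apply/costabP; split=> // j nAj; apply: fa; apply: contraNneq nAj => ->.
  by rewrite eqAB => /costabP[_]; apply.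
by move=> A B eqAB; apply/eqP; rewrite eqEsubset !sub.
Qed.

End Stabilisers.

Lemma minimal_base_normal_meet_embeddable n :
  minimal_base_size G n -> normal_meet_embeddable G n.
Proof.
move=> [Omega [to [p minp]]].
pose f A : {group gT} := costab_group to p A.
have fI : {morph f : A B / A :&: B >-> (A :&: B)%G}.
  by move=> A B; apply: val_inj; rewrite /= costabI.
exists (f @: setT), f; split; last exact: costab0_normal minp.1.
- split.
  + by move=> _ /imsetP[A _ ->]; apply/subsetP=> a /costabP[].
  + by apply/imsetP; exists setT => //; apply: val_inj; rewrite /= costabT.
  + by move=> _ _ /imsetP[A _ ->] /imsetP[B _ ->]; rewrite -fI imset_f.
- by split=> // A B eqAB; apply: (costab_inj minp); apply: (congr1 val eqAB).
Qed.

Section QuotientTranslation.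

Variable N : {group gT}.
Hypothesis nNG : G \subset 'N(N).

Lemma quotient_translation_is_action :
  is_action G (fun (X : {set coset_of N}) a => X :* coset N a).
Proof.
split=> [a | X a b Ga Gb]; first exact: can_inj (rcosetK _).
by rewrite morphM ?(subsetP nNG) // rcosetM.
Qed.

(** All subsets of the quotient are points: one action then serves every
    subgroup between N and G at once, each being the stabiliser of its image,
    and N is trivial on all points. *)
Definition quotient_translation := Action quotient_translation_is_action.

Lemma fixes_quotient_translation (M : {group gT}) a :
  N \subset M -> M \subset G -> a \in G ->
  fixes quotient_translation a (M / N) <-> a \in M.
Proof.
move=> sNM sMG Ga; have nNM := subset_trans sMG nNG.
have nNa := subsetP nNG a Ga.
have -> : (a \in M) = (coset N a \in M / N).
  apply/idP/idP=> [Ma|]; first exact: mem_quotient.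
  case/morphimP=> m nNm Mm /(rcoset_kercosetP nNa nNm)/rcosetP[y Ny ->].
  by rewrite groupM // (subsetP sNM).
split=> [fix_a | Ma]; last exact: rcoset_id.
by rewrite -(fix_a : M / N :* coset N a = M / N) rcoset_refl.
Qed.

Lemma quotient_translation_fixes_all a X :
  a \in N -> fixes quotient_translation a X.
Proof. by move=> Na; rewrite /fixes /= coset_id ?mulg1. Qed.

End QuotientTranslation.

Lemma normal_meet_embeddable_minimal_base n :
  normal_meet_embeddable G n -> minimal_base_size G n.
Proof.
move=> [S [f [[sSG SG _] [inj_f defS fI] /andP[_ nNG]]]].
have sfG A : f A \subset G by apply: sSG; rewrite -defS imset_f.
have fS (A B : {set 'I_n}) : A \subset B -> f A \subset f B.
  by move=> /setIidPl <-; rewrite fI subsetIr.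
have fT a : a \in G -> a \in f setT.
  move: SG; rewrite -defS => /imsetP[A _ ->].
  exact: subsetP (fS _ _ (subsetT A)) a.
have fixP i a : a \in G ->
    fixes (quotient_translation nNG) a (f [set~ i] / f set0) <->
      a \in f [set~ i].
  by move=> Ga; apply: fixes_quotient_translation; rewrite ?sfG ?fS ?sub0set.
exists {set coset_of (f set0)}, (quotient_translation nNG).
exists (fun i => f [set~ i] / f set0); split=> [a Ga fa X | i fix_i].
- apply: quotient_translation_fixes_all.
  (* the empty set is the intersection of the coatoms *)
  have <- : \bigcap_(i : 'I_n) [set~ i] = set0.
    apply/setP=> i; rewrite inE.
    by apply/bigcapP=> /(_ i isT); rewrite !inE eqxx.
  apply: (big_ind (fun A => a \in f A)) => [|A B fAa fBa|i _].
  + exact: fT.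
  + by rewrite fI inE fAa.
  + by apply/fixP.
- have sfi : f [set i] \subset f [set~ i].
    apply/subsetP=> a fia; have Ga := subsetP (sfG _) a fia.
    apply/(fixP i a Ga)/fix_i => // j ne_ji; apply/fixP => //.
    by apply: subsetP fia; apply: fS; rewrite sub1set !inE eq_sym.
  (* the atom would thus have the same image as the bottom *)
  have /inj_f/setP/(_ i) : f ([set i] :&: [set~ i]) = f [set i].
    by apply: val_inj; rewrite fI /=; apply/setIidPl.
  by rewrite !inE eqxx.
Qed.

End Meets.

(** * The largest embeddable Boolean lattices *)

Theorem proposition3p2 (gT : finGroupType) (G : {group gT}) :
  is_largest (join_embeddable G) (mu' G) /\
  is_largest (normal_meet_embeddable G) (b2 G).
Proof.
split; split.
- by have [X [indX sXG <-]] := mu'_attained G; apply: independent_join_embeddable.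
- by move=> m /join_embeddable_independent[X [indX sXG <-]]; apply: leq_card_mu'.
- rewrite /b2; case: ex_maxnP => n /asboolP base_n _.
  exact: minimal_base_normal_meet_embeddable.
- move=> m /normal_meet_embeddable_minimal_base base_m.
  by rewrite /b2; case: ex_maxnP => n _; apply; apply/asboolP.
Qed.
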